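(* For every real $p\ge 1$, the set of all rational functions of the form $$g_n(z)=\sum_{k=1}^n\frac{1}{z-z_k},\qquad n\in\{1,2,\dots\},\quad |z_1|=\dots=|z_n|=1,$$ (those belonging to $L_p[-1,1]$, when restricted to $[-1,1]$) is not dense in the complex space $L_p[-1,1]$.
   Context: $L_p[-1,1]$ is the space of complex-valued measurable functions on the real segment $[-1,1]$ with the norm $\big(\int_{-1}^1|f(x)|^p\,dx\big)^{1/p}$. The points $z_k\in\mathbb{C}$ need not be distinct. *)

(* Defs.v *)
From HB Require Import structures.
From mathcomp Require Import all_boot all_order all_algebra.
From mathcomp Require Import all_classical all_reals all_analysis.
From mathcomp Require Import complex.

Set Implicit Arguments.
Unset Strict Implicit.
Unset Printing Implicit Defensive.

Import Order.TTheory GRing.Theory Num.Theory.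

Local Open Scope classical_set_scope.
Local Open Scope ring_scope.
Local Open Scope complex_scope.

(* Elements of L_p[-1,1] are represented by total functions R -> R[i]; only the
   values on the segment `[-1, 1] matter.  Functions that agree almost
   everywhere are not identified: they are at Lp_norm-distance 0, so the
   quotient has the same dense subsets. *)

(* R[i] carries no measurable structure in the library, hence the
   componentwise formulation. *)
Definition cmeasurable_fun (R : realType) (D : set R) (f : R -> R[i]) : Prop :=
  measurable_fun D (fun x => complex.Re (f x)) /\
  measurable_fun D (fun x => complex.Im (f x)).

(* [ComplexField.Normc.normc] is the R-valued modulus; the generic `|_| on R[i]
   takes its values in R[i]. *)
Definition Lp_norm (R : realType) (p : R) (f : R -> R[i]) : \bar R :=
  ((\int[@lebesgue_measure R]_(x in `[(-1)%R, 1%R])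
      ((ComplexField.Normc.normc (f x)) `^ p)%:E) `^ p^-1)%E.

Definition Lp_space (R : realType) (p : R) : set (R -> R[i]) :=
  [set f | cmeasurable_fun `[-1, 1] f /\ (Lp_norm p f < +oo)%E].

(* Density of a subset S of Lp_space p for the distance given by Lp_norm p. *)
Definition dense_in_Lp (R : realType) (p : R) (S : set (R -> R[i])) : Prop :=
  forall f : R -> R[i], Lp_space p f ->
  forall e : R, 0 < e ->
  exists2 g : R -> R[i], S g & (Lp_norm p (fun x => (f x - g x)%R) < e%:E)%E.

Definition simple_fraction (R : realType) (n : nat) (z : 'I_n -> R[i])
    (w : R[i]) : R[i] :=
  \sum_(k < n) (w - z k)^-1.

(* On `[-1, 1] a pole can only be an endpoint, where the convention 0^-1 = 0
   assigns a value on a null set. *)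
Definition circle_simple_fractions (R : realType) : set (R -> R[i]) :=
  [set g | exists (n : nat) (z : 'I_n -> R[i]),
     [/\ (0 < n)%N, forall k : 'I_n, `|z k| = 1
       & g = (fun x : R => simple_fraction z x%:C)]].
Arguments circle_simple_fractions : clear implicits.

(* Main.v *)
Require Import Defs.
From mathcomp Require Import all_boot all_order all_algebra.
From mathcomp Require Import all_classical all_reals all_analysis.
From mathcomp Require Import complex.
From mathcomp Require Import measurable_realfun ring lra.

Set Implicit Arguments.
Unset Strict Implicit.
Unset Printing Implicit Defensive.

Import Order.TTheory GRing.Theory Num.Theory.

Local Open Scope classical_set_scope.
Local Open Scope ring_scope.

(** The zero function is already out of reach: the norm of every such fraction
g on [-1,1] is at least a positive constant depending on p alone.

If |z| = 1 and x = 1 - t lies in (0,1), then 2 x Re (1/(x - z)) = 1 - P(t),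
where P is the Poisson kernel with pole z, so 2 x Re g(x) is n minus a sum K(t)
of n Poisson kernels ([Re_simple_fraction]).  A small g would force K to be
close to n on (0,1) in the mean.  This fails within a distance of order 1/n
from t = 0, because every term of K is positive and has the same shape: linear
growth up to t = |1 - z|, then decay like 1/t.  With d = 1 - Re z,
  P(t) = t (2 - t) / (t^2 + 2 (1 - t) d),   |1 - z|^2 = 2 d,
and there are two cases, compared at the scale s = 1/(8 n).
 - Some pole has 2 d <= s^2.  Its kernel alone behaves like 1/t beyond s, and
   K >= 2 n on the whole of [s, 2 s] ([poisson_sum_near_pole]).
 - All poles have 2 d >= s^2.  Every kernel is then comparable to a linear
   function on (0, s], hence so is K ([poisson_sum_far_poles]); a function
   comparable to a linear one is not close to the constant n both near 0 and
   near s.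
Either way K differs from n by at least n/2 on an interval of length at least
1/(192 n) ([poisson_sum_deviation]), so |g| >= n/4 there, and
  int |g|^p >= (n/4)^p / (192 n) >= (1/4)^p / 192,
the last step because n^p >= n. *)

(** * Sums of Poisson kernels near a boundary point *)

(** The sum, over unit vectors z_k with d_k = 1 - Re z_k, of the Poisson kernels
(1 - x^2) / |x - z_k|^2 at the real point x = 1 - t. *)
Definition poisson_sum (R : realFieldType) n (d : 'I_n -> R) (t : R) : R :=
  \sum_(k < n) t * (2 - t) / (t ^+ 2 + 2 * (1 - t) * d k).

Lemma poisson_term_ge0 (R : realFieldType) (d t : R) :
  0 <= d -> 0 < t < 1 -> 0 <= t * (2 - t) / (t ^+ 2 + 2 * (1 - t) * d).
Proof.
move=> d0 /andP[t0 t1]; apply: divr_ge0; first by apply: mulr_ge0; lra.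
by apply: addr_ge0; [exact: sqr_ge0|do 2 apply: mulr_ge0 => //; lra].
Qed.

(** All kernels are nonnegative, so one of them bounds the sum from below; if
its pole is within distance t of the point 1, its denominator is at most 2 t^2
and its value at least 1 / (2 t). *)
Lemma poisson_sum_near_pole (R : realFieldType) n (d : 'I_n -> R) (k : 'I_n)
    (t : R) : (forall j, 0 <= d j) -> 2 * d k <= t ^+ 2 ->
  0 < t <= (4 * n%:R)^-1 -> 2 * n%:R <= poisson_sum d t.
Proof.
move=> d0 dk /andP[t0 tn].
have n1 : (1 : R) <= n%:R by rewrite ler1n (leq_ltn_trans _ (ltn_ord k)).
have t4 : 4 * n%:R * t <= 1 by rewrite mulrC -ler_pdivlMr ?mul1r//; nra.
have t1 : t < 1 by nra.
rewrite /poisson_sum (bigD1 k)//=; apply: ler_wpDr.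
  by apply: sumr_ge0 => j _; apply: poisson_term_ge0; rewrite ?d0// t0.
have dk0 := d0 k.
have q0 : 0 < t ^+ 2 + 2 * (1 - t) * d k.
  by apply: ltr_pwDl; [exact: exprn_gt0|do 2 apply: mulr_ge0 => //; lra].
have q2 : t ^+ 2 + 2 * (1 - t) * d k <= 2 * t ^+ 2 by nra.
rewrite ler_pdivlMr//.
apply: (@le_trans _ _ (2 * n%:R * (2 * t ^+ 2))).
  by apply: ler_wpM2l => //; lra.
by nra.
Qed.

(** The denominators of the kernels vary at most by a constant factor on (0, s]:
there t^2 <= s^2 <= 2 d, so they lie between (7/4) d and 4 d. *)
Lemma poisson_sum_far_poles (R : realFieldType) n (d : 'I_n -> R) (s : R) :
    s <= 8^-1 -> (forall k, 0 < s ^+ 2 <= 2 * d k) ->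
  exists2 m : R, 0 <= m & forall t, 0 < t <= s ->
    m * t <= poisson_sum d t <= 3 * m * t.
Proof.
move=> s8 ds; have d0 k : 0 < d k by have /andP[] := ds k; lra.
(* t (2 - t) / q lies between (15/32) t / d and (8/7) t / d, and
   2/5 <= 15/32 while 8/7 <= 3 * 2/5. *)
exists (\sum_(k < n) (2 / 5) / d k).
  by apply: sumr_ge0 => k _; rewrite divr_ge0// ?ltW//; lra.
move=> t /andP[t0 ts].
rewrite mulr_sumr !mulr_suml /poisson_sum.
apply/andP; split; apply: ler_sum => k _.
all: have dk := d0 k; have /andP[_ dsk] := ds k.
all: have q0 : 0 < t ^+ 2 + 2 * (1 - t) * d k by nra.
  rewrite ler_pdivlMr//.
  have -> : 2 / 5 / d k * t * (t ^+ 2 + 2 * (1 - t) * d k) =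
    t * (2 / 5 * (t ^+ 2 + 2 * (1 - t) * d k) / d k) by field; rewrite gt_eqF.
  rewrite ler_pM2l// ler_pdivrMr//.
  have : t ^+ 2 <= s ^+ 2 by rewrite ler_sqr ?nnegrE; lra.
  by nra.
rewrite ler_pdivrMr//.
have -> : 3 * (2 / 5 / d k) * t * (t ^+ 2 + 2 * (1 - t) * d k) =
  6 / 5 * t * (t ^+ 2 / d k + 2 * (1 - t)) by field; rewrite gt_eqF.
have : 0 <= t ^+ 2 / d k by rewrite divr_ge0 ?sqr_ge0 ?ltW.
by nra.
Qed.

(** The bounds 0 and 1/4 on the interval keep x = 1 - t away from the points 1,
where a pole may sit, and 0, where the relation between Poisson kernels and
simple fractions carries no information. *)
Lemma poisson_sum_deviation (R : realFieldType) n (d : 'I_n -> R) :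
  (0 < n)%N -> (forall k, 0 <= d k) ->
  exists ab : R * R, [/\ 0 < ab.1, ab.2 <= 4^-1,
     (192 * n%:R)^-1 <= ab.2 - ab.1 &
     forall t, ab.1 <= t <= ab.2 -> n%:R / 2 <= `|poisson_sum d t - n%:R| ].
Proof.
move=> n0 d0; set N := n%:R : R.
have N1 : 1 <= N by rewrite ler1n.
pose u := N^-1; have uN : u * N = 1 by rewrite mulVf//; lra.
have u0 : 0 < u by rewrite invr_gt0; lra.
have u1 : u <= 1 by nra.
have u192 : (192 * N)^-1 = u / 192 by rewrite invfM mulrC.
have u4 : (4 * N)^-1 = u / 4 by rewrite invfM mulrC.
have [s sE] : exists s, s = u / 8 by exists (u / 8).
have [/existsP[k dk]|] := boolP [exists k, 2 * d k <= s ^+ 2].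
  exists (s, u / 4); split => /=; rewrite ?u192; try lra.
  move=> t /andP[st tu].
  suff h : 2 * N <= poisson_sum d t.
    by rewrite ler_normr; apply/orP; left; lra.
  apply: (@poisson_sum_near_pole _ _ _ k) => //.
    by apply: le_trans dk _; rewrite ler_sqr ?nnegrE//; lra.
  by rewrite u4 tu andbT; lra.
rewrite negb_exists => /forallP ds.
have s0 : 0 < s by lra.
have [||m m0 mP] := @poisson_sum_far_poles R n d s.
- by lra.
- by move=> k; rewrite exprn_gt0//= ltW// ltNge.
(* If m s <= 2 n, the upper bound 3 m t keeps the sum below n/2 near 0;
   otherwise the lower bound m t keeps it above 3n/2 near s. *)
have [ms|ms] := leP (m * s) (2 * N).
  exists (s / 24, s / 12); split => /=; rewrite ?u192; try lra.
  move=> t /andP[t1 t2].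
  have /andP[_ h] : m * t <= poisson_sum d t <= 3 * m * t by apply: mP; lra.
  suff h' : 3 * m * t <= N / 2.
    by rewrite ler_normr; apply/orP; right; lra.
  by nra.
exists (3 / 4 * s, s); split => /=; rewrite ?u192; try lra.
move=> t /andP[t1 t2].
have /andP[h _] : m * t <= poisson_sum d t <= 3 * m * t by apply: mP; lra.
suff h' : 3 / 2 * N <= m * t.
  by rewrite ler_normr; apply/orP; left; lra.
by nra.
Qed.

(** * Real parts of simple fractions with poles on the unit circle *)

Lemma Re_sum (R : realType) (I : Type) (s : seq I) (F : I -> R[i]) :
  complex.Re (\sum_(i <- s) F i) = \sum_(i <- s) complex.Re (F i).
Proof. by apply: (big_morph (@complex.Re R)) => [[? ?] [? ?]|]. Qed.

Lemma normc_ge_absRe (R : realType) (w : R[i]) :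
  `|complex.Re w| <= ComplexField.Normc.normc w.
Proof.
case: w => a b /=; rewrite -sqrtr_sqr ler_sqrt ?addr_ge0 ?sqr_ge0//.
by rewrite lerDl sqr_ge0.
Qed.

Lemma circle_sqr (R : realType) (z : R[i]) :
  `|z| = 1 -> complex.Re z ^+ 2 + complex.Im z ^+ 2 = 1.
Proof.
rewrite normc_def => -[/(congr1 (fun x => x ^+ 2))].
by rewrite sqr_sqrtr ?addr_ge0 ?sqr_ge0// expr1n.
Qed.

Lemma circle_Re_le1 (R : realType) (z : R[i]) : `|z| = 1 -> complex.Re z <= 1.
Proof. by move=> /circle_sqr; nra. Qed.

(** This is the identity |x - z|^2 = (1 - x)^2 + 2 x (1 - Re z) for a unit
vector z and x = 1 - t, which turns 2 x (x - Re z) into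
|x - z|^2 - (1 - x^2). *)
Lemma Re_simple_pole (R : realType) (z : R[i]) (t : R) :
  `|z| = 1 -> 0 < t < 1 ->
  2 * (1 - t) * complex.Re (((1 - t)%:C%C - z)^-1) =
  1 - t * (2 - t) / (t ^+ 2 + 2 * (1 - t) * (1 - complex.Re z)).
Proof.
move=> z1 /andP[t0 t1]; have := circle_sqr z1; have := circle_Re_le1 z1.
case: z z1 => c s _ /= c1 cs.
have q0 : 0 < t ^+ 2 + 2 * (1 - t) * (1 - c).
  by apply: ltr_pwDl; [exact: exprn_gt0|rewrite !mulr_ge0//; lra].
have -> : (1 - t - c) ^+ 2 + (0 - s) ^+ 2 = t ^+ 2 + 2 * (1 - t) * (1 - c).
  have -> : (0 - s) ^+ 2 = 1 - c ^+ 2 by rewrite -cs; ring.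
  by ring.
by field; rewrite gt_eqF.
Qed.

Lemma Re_simple_fraction (R : realType) n (z : 'I_n -> R[i]) (t : R) :
  (forall k, `|z k| = 1) -> 0 < t < 1 ->
  2 * (1 - t) * complex.Re (simple_fraction z (1 - t)%:C%C) =
  n%:R - poisson_sum (fun k => 1 - complex.Re (z k)) t.
Proof.
move=> z1 t01; rewrite /simple_fraction Re_sum mulr_sumr.
rewrite (eq_bigr _ (fun k _ => Re_simple_pole (z1 k) t01)) sumrB.
by rewrite sumr_const card_ord.
Qed.

(** The deviation of the Poisson sum from n, transported by x = 1 - t; dividing
by 2 x <= 2 costs the second factor 1/2. *)
Lemma simple_fraction_ge (R : realType) n (z : 'I_n -> R[i]) :
  (0 < n)%N -> (forall k, `|z k| = 1) ->
  exists ab : R * R, [/\ `[ab.1, ab.2] `<=` `[-1, 1]%classic,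
     (192 * n%:R)^-1 <= ab.2 - ab.1 &
     forall x, x \in `[ab.1, ab.2] ->
       n%:R / 4 <= ComplexField.Normc.normc (simple_fraction z x%:C%C)].
Proof.
move=> n0 z1.
have [|[a b] /= [a0 b4 ab h]] :=
  @poisson_sum_deviation R n (fun k => 1 - complex.Re (z k)) n0.
  by move=> k; rewrite subr_ge0 circle_Re_le1.
exists (1 - b, 1 - a); split => /=.
- by move=> x /=; rewrite !in_itv/= => /andP[]; lra.
- by lra.
move=> x; rewrite in_itv/= => /andP[bx xa].
have := h (1 - x); rewrite distrC -Re_simple_fraction//; last by lra.
rewrite subKr normrM ger0_norm; last by lra.
move=> /(_ ltac:(lra)) hx.
apply: le_trans (normc_ge_absRe _).
set r := `|_| in hx *; have : 0 <= r by rewrite /r.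
by nra.
Qed.

(** * Lower bounds for the norm *)

Lemma measurable_normc (R : realType) (D : set R) (f : R -> R[i]) :
  cmeasurable_fun D f ->
  measurable_fun D (fun x => ComplexField.Normc.normc (f x)).
Proof.
move=> [mRe mIm].
rewrite (_ : (fun x => _) = Num.sqrt \o
  (fun x => complex.Re (f x) ^+ 2 + complex.Im (f x) ^+ 2)); last first.
  by apply/funext => x /=; case: (f x).
apply: measurableT_comp.
  by apply: continuous_measurable_fun; exact: sqrt_continuous.
by apply: measurable_funD; exact: measurable_funX.
Qed.

Lemma measurable_normc_powR (R : realType) (D : set R) (f : R -> R[i])
    (p : R) :
  cmeasurable_fun D f ->
  measurable_fun D (fun x => ((ComplexField.Normc.normc (f x)) `^ p)%:E).
Proof.
move=> mf; apply/measurable_EFinP.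
by apply: (measurableT_comp (measurable_powR p)); exact: measurable_normc.
Qed.

Lemma Lp_integral_ge (R : realType) (p a b c : R) (f : R -> R[i]) :
  0 <= p -> 0 <= c -> a <= b -> `[a, b] `<=` `[-1, 1]%classic ->
  cmeasurable_fun `[-1, 1] f ->
  (forall x, x \in `[a, b] -> c <= ComplexField.Normc.normc (f x)) ->
  ((c `^ p * (b - a))%:E <= \int[@lebesgue_measure R]_(x in `[(-1)%R, 1%R])
      ((ComplexField.Normc.normc (f x)) `^ p)%:E)%E.
Proof.
move=> p0 c0 ab sub mf cf.
have mg := measurable_normc_powR p mf.
apply: (@le_trans _ _ (\int[@lebesgue_measure R]_(x in `[a, b])
      ((ComplexField.Normc.normc (f x)) `^ p)%:E)%E); last first.
  by apply: ge0_subset_integral => // x _; rewrite lee_fin powR_ge0.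
apply: (@le_trans _ _
  (\int[@lebesgue_measure R]_(x in `[a, b]) (cst (c `^ p)%:E x))%E).
  rewrite integral_cst//= lebesgue_measure_itv/= lte_fin.
  by case: ltgtP ab => [||->] _ //; rewrite subrr mulr0 mule0.
apply: ge0_le_integral => //.
- by move=> x _; rewrite lee_fin powR_ge0.
- exact: measurable_funS mg.
move=> x abx; rewrite lee_fin ge0_ler_powR ?nnegrE//; last exact: cf.
exact: le_trans (cf _ abx).
Qed.

Lemma Lp_space0 (R : realType) (p : R) :
  1 <= p -> Lp_space p (fun _ : R => (0 : R[i])).
Proof.
move=> p1; have p0 : p != 0 by rewrite gt_eqF; lra.
split; first by split; exact: measurable_cst.
rewrite /Lp_norm integral0_eq; first by rewrite poweR0r ?invr_eq0.
by move=> x _; rewrite ComplexField.Normc.normc0 powR0.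
Qed.

(** A fraction with n poles is at least n/4 on an interval of length 1/(192 n),
and (n/4)^p / n >= (1/4)^p because n^p >= n: the number of poles disappears
from the bound. *)
Lemma Lp_norm_circle_ge (R : realType) (p : R) (g : R -> R[i]) : 1 <= p ->
  circle_simple_fractions R g -> Lp_space p g ->
  (((4^-1 `^ p / 192) `^ p^-1)%:E <= Lp_norm p g)%E.
Proof.
move=> p1 [n [z [n0 z1 gE]]] [mg _].
have [[a b] /= [sub ab h]] := simple_fraction_ge n0 z1.
have N1 : 1 <= n%:R :> R by rewrite ler1n.
have l0 : 0 < (192 * n%:R)^-1 :> R by rewrite invr_gt0; lra.
rewrite /Lp_norm -poweR_EFin; apply: gt0_ler_poweR.
- by rewrite invr_ge0; lra.
- by rewrite in_itv/= leey andbT lee_fin divr_ge0// powR_ge0.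
- rewrite in_itv/= leey andbT integral_ge0// => x _.
  by rewrite lee_fin powR_ge0.
have hg x : x \in `[a, b] -> n%:R / 4 <= ComplexField.Normc.normc (g x).
  by move=> xab; rewrite gE h.
apply: le_trans (Lp_integral_ge _ _ _ sub mg hg); [|lra..].
rewrite lee_fin powRM//; [|lra..].
have Np : n%:R <= n%:R `^ p :> R by rewrite -[X in X <= _]powRr1 ?ler_powR; lra.
rewrite [X in _ <= X * _]mulrC -mulrA ler_wpM2l ?powR_ge0//.
apply: (@le_trans _ _ (n%:R * (192 * n%:R)^-1)).
  by rewrite invfM mulrCA divff ?mulr1//; lra.
by apply: ler_pM; lra.
Qed.

Theorem mainTheorem3 (R : realType) (p : R) (hp : 1 <= p) :
  ~ dense_in_Lp p (circle_simple_fractions R `&` Lp_space p).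
Proof.
pose e : R := (4^-1 `^ p / 192) `^ p^-1.
have e0 : 0 < e by rewrite powR_gt0// divr_gt0// powR_gt0// invr_gt0; lra.
move=> /(_ _ (Lp_space0 hp) e e0)[g [cg Lg]]; apply/negP; rewrite -leNgt.
suff -> : Lp_norm p (fun x => 0 - g x) = Lp_norm p g.
  exact: Lp_norm_circle_ge.
congr (_ `^ _)%E; apply: eq_integral => x _.
by rewrite sub0r normcN.
Qed.
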